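(* Let $n\in\mathbb{N}$. If $f\in C[0,\infty)$ is a (real-valued) convex function of (at most) exponential growth, then $$\sum_{i=0}^{\infty}\sum_{j=0}^{\infty}\left[ s_{i}(x)\,s_{j}(x)+s_{i}(y)\,s_{j}(y)-2\,s_{i}(x)\,s_{j}(y)\right] f(i+j)\geq 0$$ for all $x,y\in[0,\infty)$.
   Context: For $\nu=0,1,2,\ldots$ and $x\in[0,\infty)$, the Mirakyan-Favard-Szász basis functions are $s_{\nu}(x)=e^{-x}\frac{x^{\nu}}{\nu!}$ (with the convention $0^0=1$). $C[0,\infty)$ denotes the continuous real-valued functions on $[0,\infty)$. A function $f$ on $[0,\infty)$ is of (at most) exponential growth if there are constants $C,A\ge 0$ such that $|f(t)|\le C e^{At}$ for all $t\ge 0$. The number $n$ does not occur in the inequality. *)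

(* Defs.v *)
From mathcomp Require Import all_boot all_order all_algebra.
From mathcomp Require Import all_classical all_reals all_analysis.

Set Implicit Arguments.
Unset Strict Implicit.
Unset Printing Implicit Defensive.

Import Order.TTheory GRing.Theory Num.Theory.
Import numFieldNormedType.Exports.

Local Open Scope classical_set_scope.
Local Open Scope ring_scope.

(* The convention 0 ^ 0 = 1 holds since x ^+ 0 = 1 for every x. *)
Definition szasz_basis (R : realType) (nu : nat) (x : R) : R :=
  expR (- x) * (x ^+ nu / nu`!%:R).

Definition exponential_growth (R : realType) (f : R -> R) : Prop :=
  exists C A : R, [/\ 0 <= C, 0 <= A &
    forall t : R, 0 <= t -> `|f t| <= C * expR (A * t)].

(* Main.v *)
(* The operators P_t g(m) = E g(m + N_t), with N_t Poisson of mean t, form a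
   semigroup on geometrically bounded sequences: P_u P_v = P_(u+v), since
   Poisson laws are closed under convolution.  The double sum is
   P_x P_x g(0) + P_y P_y g(0) - 2 P_x P_y g(0) with g(k) = f(k), and is symmetric in x, y.
   If y = x + d with d >= 0, it equals P_(2x) (P_d P_d g - 2 P_d g + g)(0), and
   P_d P_d g - 2 P_d g + g >= 0 pointwise: it is the expectation of
   g(m + i + j) - g(m + i) - g(m + j) + g(m) over independent Poisson i, j. *)
Require Import Defs.
From mathcomp Require Import all_boot all_order all_algebra.
From mathcomp Require Import all_classical all_reals all_analysis.
From mathcomp Require Import ring lra.

Set Implicit Arguments.
Unset Strict Implicit.
Unset Printing Implicit Defensive.

Import Order.TTheory GRing.Theory Num.Theory.
Import numFieldNormedType.Exports.

Local Open Scope classical_set_scope.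
Local Open Scope ring_scope.

(** Samples at the naturals of a function of exponential growth belong to this class, and
    [szasz_op t] with [0 <= t] preserves it, so iterated averages converge. *)
Definition geometric_growth (R : realType) (g : nat -> R) : Prop :=
  exists C B : R, [/\ 0 <= C, 0 <= B & forall k, `|g k| <= C * B ^+ k].

(* [szasz_op t g m] is the expectation of [g (m + N)] for [N] Poisson of mean [t]. *)
Definition szasz_op (R : realType) (t : R) (g : nat -> R) (m : nat) : R :=
  limn (series (fun k => szasz_basis k t * g (m + k)%N)).

(** * Poisson averages: convergence, linearity and growth *)

Section szasz_operator.
Context {R : realType}.
Implicit Types (g h : nat -> R) (t u v : R) (m k : nat).

Lemma szasz_basis_ge0 k t : 0 <= t -> 0 <= szasz_basis k t.
Proof. by move=> t0; rewrite /szasz_basis mulr_ge0 ?expR_ge0 ?divr_ge0 ?exprn_ge0. Qed.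

(** This is the binomial theorem for [(u + v) ^+ k], read as the closure of Poisson laws under
    convolution. *)
Lemma szasz_basisD k u v :
  \sum_(i < k.+1) szasz_basis i u * szasz_basis (k - i) v = szasz_basis k (u + v).
Proof.
rewrite /szasz_basis opprD expRD addrC exprDn mulr_suml mulr_sumr.
apply: eq_bigr => i _.
have ik : (i <= k)%N by rewrite -ltnS.
have fact_neq0 j : j`!%:R != 0 :> R by rewrite pnatr_eq0 -lt0n fact_gt0.
have bin : ('C(k, i))%:R = k`!%:R / (i`!%:R * (k - i)`!%:R) :> R.
  by rewrite -(bin_fact ik) !natrM; field; rewrite !fact_neq0.
rewrite -(mulr_natl _ 'C(k, i)) bin; field.
by rewrite !fact_neq0.
Qed.

(** The exponential series at [t * B] is thus a majorant, which yields absolute convergence. *)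
Lemma norm_szasz_term_le g C B t m k : 0 <= t -> 0 <= B ->
    (forall k, `|g k| <= C * B ^+ k) ->
  `|szasz_basis k t * g (m + k)%N| <= expR (- t) * C * B ^+ m * exp_coeff (t * B) k.
Proof.
move=> t0 B0 gB; rewrite normrM (ger0_norm (szasz_basis_ge0 k t0)).
apply: le_trans (ler_wpM2l (szasz_basis_ge0 k t0) (gB _)) _.
rewrite /szasz_basis /exp_coeff /= exprD exprMn le_eqVlt; apply/orP; left; apply/eqP.
by ring.
Qed.

Lemma is_cvg_szasz g t m : 0 <= t -> geometric_growth g ->
  cvgn (series (fun k => szasz_basis k t * g (m + k)%N)).
Proof.
move=> t0 [C [B [C0 B0 gB]]]; apply: normed_cvg.
apply: (@series_le_cvg _ _ (expR (- t) * C * B ^+ m *: exp_coeff (t * B))) => //=.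
- move=> k; apply: mulr_ge0; first by rewrite !mulr_ge0 ?expR_ge0 ?exprn_ge0.
  exact/exp_coeff_ge0/mulr_ge0.
- by move=> k; exact: norm_szasz_term_le.
- exact/is_cvg_seriesZ/is_cvg_series_exp_coeff.
Qed.
Arguments is_cvg_szasz {g t} m.

Lemma geometric_growth_pow (C B : R) :
  0 <= C -> 0 <= B -> geometric_growth (fun k => C * B ^+ k).
Proof. by move=> C0 B0; exists C, B; split=> // k; rewrite ger0_norm ?mulr_ge0 ?exprn_ge0. Qed.

Lemma geometric_growth_lin (a b : R) g h : geometric_growth g -> geometric_growth h ->
  geometric_growth (fun k => a * g k + b * h k).
Proof.
move=> [C [B [C0 B0 gB]]] [D [A [D0 A0 hA]]].
exists (`|a| * C + `|b| * D), (B + A); split=> [||k]; first by rewrite addr_ge0 ?mulr_ge0.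
  exact: addr_ge0.
rewrite (le_trans (ler_normD _ _))// !normrM mulrDl -!mulrA lerD// ler_wpM2l//.
  by rewrite (le_trans (gB k))// ler_wpM2l// lerXn2r ?nnegrE ?addr_ge0 ?lerDl.
by rewrite (le_trans (hA k))// ler_wpM2l// lerXn2r ?nnegrE ?addr_ge0 ?lerDr.
Qed.

Lemma szasz_op_lin (a b : R) g h t m :
    0 <= t -> geometric_growth g -> geometric_growth h ->
  szasz_op t (fun k => a * g k + b * h k) m = a * szasz_op t g m + b * szasz_op t h m.
Proof.
move=> t0 gg gh; have cg := is_cvg_szasz m t0 gg; have ch := is_cvg_szasz m t0 gh.
rewrite /szasz_op -[a * _](lim_seriesZ a cg) -[b * _](lim_seriesZ b ch).
rewrite -lim_seriesD; [|exact: is_cvg_seriesZ|exact: is_cvg_seriesZ].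
by congr (limn (series _)); apply/funext => k /=; rewrite !fctE/= /GRing.scale/=; ring.
Qed.

Lemma szasz_op_ge0 g t m : 0 <= t -> geometric_growth g -> (forall k, 0 <= g k) ->
  0 <= szasz_op t g m.
Proof.
move=> t0 gg g0; apply: limr_ge; first exact: is_cvg_szasz.
by apply: nearW => k; rewrite sumr_ge0// => i _; rewrite mulr_ge0// szasz_basis_ge0.
Qed.

(** The ratio [B] survives: [B ^+ (m + k)] splits, [B ^+ m] leaves the dominating series, and what
    remains is the new constant, the average of the majorant at 0. *)
Lemma geometric_growth_szasz_op g t :
  0 <= t -> geometric_growth g -> geometric_growth (szasz_op t g).
Proof.
move=> t0 [C [B [C0 B0 gB]]].
have gpow := geometric_growth_pow C0 B0.
exists (szasz_op t (fun k => C * B ^+ k) 0), B; split=> // [|m].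
  by apply: szasz_op_ge0 => // k; rewrite mulr_ge0 ?exprn_ge0.
have := is_cvg_szasz 0 t0 gpow => c0; have := is_cvg_szasz m t0 gpow => cm.
have cn : cvgn [normed series (fun k => szasz_basis k t * g (m + k)%N)].
  apply: series_le_cvg cm => [k|k|k]/=; first exact: normr_ge0.
    by rewrite !mulr_ge0 ?szasz_basis_ge0 ?exprn_ge0.
  by rewrite normrM (ger0_norm (szasz_basis_ge0 k t0)) ler_wpM2l ?szasz_basis_ge0.
rewrite (le_trans (lim_series_norm cn))// mulrC -[leRHS](lim_seriesZ (B ^+ m) c0).
apply: lim_series_le => // [|k]; first exact: is_cvg_seriesZ.
rewrite /= normrM (ger0_norm (szasz_basis_ge0 k t0)).
rewrite (le_trans (ler_wpM2l (szasz_basis_ge0 k t0) (gB _)))// le_eqVlt; apply/orP; left.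
by apply/eqP; rewrite !fctE /GRing.scale/= add0n exprD; ring.
Qed.

(** * Double series and the semigroup law *)

Lemma nneseries_EFin (w : nat -> R) : cvgn (series w) ->
  (\sum_(k <oo) (w k)%:E)%E = (limn (series w))%:E.
Proof.
move=> cw; rewrite -EFin_lim//; congr (limn _); apply/funext => k /=.
by rewrite sumEFin.
Qed.

Lemma EFin_szasz_op g t m : 0 <= t -> geometric_growth g ->
  (szasz_op t g m)%:E = (\sum_(k <oo) (szasz_basis k t * g (m + k)%N)%:E)%E.
Proof. by move=> t0 gg; rewrite nneseries_EFin//; exact: is_cvg_szasz. Qed.

(** Tonelli: for nonnegative terms in the extended reals, sums may be interchanged without proving
    summability first. *)
Lemma nneseries_cauchy (c : nat -> nat -> R) : (forall i j, 0 <= c i j) ->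
  (\sum_(i <oo) \sum_(j <oo) (c i j)%:E)%E =
  (\sum_(k <oo) (\sum_(i < k.+1) c i (k - i)%N)%:E)%E.
Proof.
move=> c0.
(* Row [i] is shifted right by [i] and padded with zeros, so that antidiagonals become columns. *)
pose d i k := if (i <= k)%N then (c i (k - i)%N)%:E else 0%E.
have d0 i k : (0 <= d i k)%E by rewrite /d; case: ifP; rewrite ?lee_fin.
transitivity (\sum_(i <oo) \sum_(k <oo) d i k)%E.
  apply: eq_eseriesr => i _.
  rewrite [RHS](nneseries_split 0 i)// add0n big_nat big1 ?add0e; last first.
    by move=> k /andP[_ ki]; rewrite /d leqNgt ki.
  rewrite -[RHS]nneseries_addn//.
  by apply: eq_eseriesr => k _; rewrite /d leq_addl addnK.
rewrite nneseries_interchange//; apply: eq_eseriesr => k _.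
rewrite (nneseries_split 0 k.+1)// add0n eseries0 ?adde0; last first.
  by move=> i ki _; rewrite /d leqNgt ki.
rewrite big_mkord -sumEFin; apply: eq_bigr => i _.
by rewrite /d -ltnS ltn_ord.
Qed.

(** Both sides sum one nonnegative double series; [szasz_basisD] evaluates each antidiagonal. *)
Let szasz_opD_ge0 g u v m : 0 <= u -> 0 <= v -> geometric_growth g ->
  (forall k, 0 <= g k) -> szasz_op u (szasz_op v g) m = szasz_op (u + v) g m.
Proof.
move=> u0 v0 gg g0; have uv0 := addr_ge0 u0 v0.
have gvg := geometric_growth_szasz_op v0 gg.
apply: EFin_inj; rewrite !EFin_szasz_op//.
pose c i j := szasz_basis i u * (szasz_basis j v * g (m + i + j)%N).
transitivity (\sum_(i <oo) \sum_(j <oo) (c i j)%:E)%E.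
  apply: eq_eseriesr => i _.
  rewrite EFinM EFin_szasz_op// -nneseriesZl//.
  by move=> j _; rewrite lee_fin mulr_ge0 ?szasz_basis_ge0.
rewrite nneseries_cauchy; last first.
  move=> i j; apply: mulr_ge0; first exact: szasz_basis_ge0.
  by apply: mulr_ge0; first exact: szasz_basis_ge0.
apply: eq_eseriesr => k _; congr EFin.
rewrite -szasz_basisD mulr_suml; apply: eq_bigr => i _.
by rewrite /c -addnA subnKC ?mulrA// -ltnS.
Qed.

Lemma szasz_opD g u v m : 0 <= u -> 0 <= v -> geometric_growth g ->
  szasz_op u (szasz_op v g) m = szasz_op (u + v) g m.
Proof.
move=> u0 v0 gg; have [C [B [C0 B0 gB]]] := gg.
(* Adding the majorant [p] makes [g] nonnegative; writing [g] as [q - p] then reduces the claim by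
   linearity to nonnegative sequences. *)
pose p k := C * B ^+ k; pose q k := 1 * g k + 1 * p k.
have gp : geometric_growth p by exact: geometric_growth_pow.
have gq : geometric_growth q by exact: geometric_growth_lin.
have uv0 := addr_ge0 u0 v0.
have p0 k : 0 <= p k by rewrite mulr_ge0 ?exprn_ge0.
have q0 k : 0 <= q k.
  by rewrite /q !mul1r -lerBlDr sub0r; have := gB k; rewrite ler_norml => /andP[].
have -> : g = fun k => 1 * q k + (-1) * p k.
  by apply/funext => k; rewrite /q; ring.
have -> : szasz_op v (fun k => 1 * q k + (-1) * p k) =
    fun k => 1 * szasz_op v q k + (-1) * szasz_op v p k.
  by apply/funext => k; rewrite szasz_op_lin.
rewrite !(szasz_op_lin 1 (-1))//; try exact: geometric_growth_szasz_op.
by rewrite !szasz_opD_ge0.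
Qed.

(** * Lower bounds and second differences *)

Lemma szasz_op_ge c g t m : 0 <= t -> geometric_growth g ->
  (forall k, c <= g (m + k)%N) -> c <= szasz_op t g m.
Proof.
move=> t0 gg cg; have cE := is_cvg_series_exp_coeff t.
(* The Poisson weights sum to 1, so [c] is its own average. *)
have -> : c = limn (series ((expR (- t) * c) *: exp_coeff t)).
  by rewrite lim_seriesZ// /GRing.scale/= -/(expR t) mulrAC -expRD addNr expR0 mul1r.
apply: lim_series_le => [||k]; [exact: is_cvg_seriesZ|exact: is_cvg_szasz|].
rewrite [leLHS](_ : _ = szasz_basis k t * c); last first.
  by rewrite fctE /GRing.scale/= /szasz_basis /exp_coeff/=; ring.
exact: (ler_wpM2l (szasz_basis_ge0 k t0) (cg k)).
Qed.

(** The two expectations are taken one at a time: averaging the hypothesis over [j] shows that [h],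
    the increment of [g] under [szasz_op d], satisfies [h m <= h (m + i)]; averaging over [i]
    concludes. *)
Lemma szasz_op_second_difference_ge0 g d m : 0 <= d -> geometric_growth g ->
    (forall k i j, g (k + i)%N + g (k + j)%N <= g k + g (k + i + j)%N) ->
  2 * szasz_op d g m <= g m + szasz_op d (szasz_op d g) m.
Proof.
move=> d0 gg g2; pose h k := 1 * szasz_op d g k + (-1) * g k.
have gdg := geometric_growth_szasz_op d0 gg.
have h_incr i : h m <= h (m + i)%N.
  have shiftE : szasz_op d g (m + i) = szasz_op d (fun k => g (k + i)%N) m.
    by congr (limn (series _)); apply/funext => k; rewrite addnAC.
  have gs : geometric_growth (fun k => g (k + i)%N).
    move: gg => [C [B [C0 B0 gB]]]; exists (C * B ^+ i), B; split=> // [|k].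
      by rewrite mulr_ge0 ?exprn_ge0.
    by rewrite -mulrA -exprD addnC.
  suff : g (m + i)%N - g m <= szasz_op d (fun k => 1 * g (k + i)%N + (-1) * g k) m.
    by rewrite szasz_op_lin// -shiftE /h; lra.
  apply: szasz_op_ge => // [|k]; first exact: geometric_growth_lin.
  by have := g2 m i k; rewrite addnAC; lra.
have := szasz_op_ge d0 (geometric_growth_lin 1 (-1) gdg gg) h_incr.
by rewrite szasz_op_lin// /h; lra.
Qed.

End szasz_operator.
Arguments is_cvg_szasz {R g t} m.
Arguments szasz_op_ge0 {R g t} m.
Arguments szasz_opD {R g u v} m.
Arguments szasz_op_second_difference_ge0 {R g d} m.

(** The two middle points are convex combinations of [k] and [k + i + j] with swapped weights, so
    the two chord bounds add up to the right-hand side. *)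
Lemma convex_second_difference (R : realType) (f : R -> R) :
    convex_function (`[0, +oo[%classic : set R) f ->
  forall k i j : nat,
    f (k + i)%:R + f (k + j)%:R <= f k%:R + f (k + i + j)%:R.
Proof.
move=> f_convex k i j; have [ij0|ij_gt0] := posnP (i + j).
  by move: ij0 => /eqP; rewrite addn_eq0 => /andP[/eqP-> /eqP->]; rewrite !addn0.
have s_gt0 : 0 < (i + j)%:R :> R by rewrite ltr0n.
have i_ge0 : 0 <= i%:R :> R by [].
have j_ge0 : 0 <= j%:R :> R by [].
have convR (t x y : R) : 0 <= t -> t <= 1 -> 0 <= x -> 0 <= y ->
    f (t * x + (1 - t) * y) <= t * f x + (1 - t) * f y.
  move=> t0 t1 x0 y0; have := f_convex (Itv01 t0 t1) x y; rewrite !inE/= !in_itv/= !andbT.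
  by move=> /(_ x0 y0).
have conv_bound (p q : nat) : (p + q = i + j)%N ->
    f (k + p)%:R <= q%:R / (i + j)%:R * f k%:R + p%:R / (i + j)%:R * f (k + i + j)%:R.
  move=> pq; have s_neq0 : p%:R + q%:R != 0 :> R by rewrite -natrD pq gt_eqF.
  have := @convR (q%:R / (i + j)%:R) k%:R (k + i + j)%:R.
  rewrite divr_ge0// ler_pdivrMr// mul1r ler_nat -pq leq_addl -addnA -pq !natrD.
  have -> : 1 - q%:R / (p%:R + q%:R) = p%:R / (p%:R + q%:R) :> R by field.
  set w := _ + _ * (_ + _); have -> : w = k%:R + p%:R by rewrite /w; field.
  by apply; rewrite ?addr_ge0.
have := conv_bound i j erefl; have := conv_bound j i (addnC j i).
have : i%:R / (i + j)%:R + j%:R / (i + j)%:R = 1 :> R.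
  by rewrite -mulrDl -natrD divff// gt_eqF.
set a := i%:R / _; set b := j%:R / _ => ab.
have -> : b = 1 - a by lra.
by lra.
Qed.

(* MathComp-Analysis.  A function on [0, +oo) is represented by f : R -> R,
   of which only the values on [0, +oo) are used.  Since limn returns a default
   value on divergent sequences, the conclusion also asserts the convergence of
   the inner series and of the outer series. *)
Theorem theorem5 (R : realType) (n : nat) (f : R -> R)
    (f_cont : {within `[0, +oo[%classic, continuous f})
    (f_convex : convex_function (`[0, +oo[%classic : set R) f)
    (f_growth : exponential_growth f)
    (x y : R) (x_ge0 : 0 <= x) (y_ge0 : 0 <= y) :
  let a (i j : nat) : R :=
    (szasz_basis i x * szasz_basis j x + szasz_basis i y * szasz_basis j y
     - 2 * szasz_basis i x * szasz_basis j y) * f (i + j)%:R in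
  [/\ forall i : nat, cvgn (series (a i)),
      cvgn (series (fun i : nat => limn (series (a i)))) &
      0 <= limn (series (fun i : nat => limn (series (a i))))].
Proof.
move=> a; pose g (k : nat) := f k%:R.
have gg : geometric_growth g.
  have [C [A [C0 A0 fA]]] := f_growth.
  (* The ratio is [expR A] because [expR (A * k)] is its [k]-th power. *)
  exists C, (expR A); split=> // k.
  by rewrite -expRM_natr; exact: fA.
have scale (c l : R) (w : R^nat) : w @ \oo --> l -> c *: w @ \oo --> c * l.
  by move=> wl; exact: (@cvgZl_tmp _ R^o).
(* Naming the limit gives both convergence and the value of [limn], ruling out its default. *)
have innerE i : series (a i) @ \oo --> szasz_basis i x * szasz_op x g i +
    szasz_basis i y * szasz_op y g i + (- 2 * szasz_basis i x) * szasz_op y g i.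
  rewrite [a i](_ : _ = szasz_basis i x *: (fun k => szasz_basis k x * g (i + k)%N) +
      szasz_basis i y *: (fun k => szasz_basis k y * g (i + k)%N) +
      (- 2 * szasz_basis i x) *: (fun k => szasz_basis k y * g (i + k)%N)); last first.
    by apply/funext => k; rewrite !fctE /GRing.scale/= /a /g; ring.
  rewrite !seriesD !seriesZ.
  by apply: cvgD; [apply: cvgD|]; apply: scale; exact: is_cvg_szasz.
have outerE : series (fun i => limn (series (a i))) @ \oo -->
    szasz_op x (szasz_op x g) 0 + szasz_op y (szasz_op y g) 0 +
    (- 2) * szasz_op x (szasz_op y g) 0.
  rewrite [X in series X](_ : _ = (fun i => szasz_basis i x * szasz_op x g i) +
      (fun i => szasz_basis i y * szasz_op y g i) +
      (- 2) *: (fun i => szasz_basis i x * szasz_op y g i)); last first.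
    apply/funext => i; rewrite !fctE /GRing.scale/= mulrA.
    by apply/cvg_lim => //; exact: innerE.
  rewrite !seriesD !seriesZ; apply: cvgD; first apply: cvgD.
  - exact: (is_cvg_szasz 0 x_ge0 (geometric_growth_szasz_op x_ge0 gg)).
  - exact: (is_cvg_szasz 0 y_ge0 (geometric_growth_szasz_op y_ge0 gg)).
  - apply: scale.
    exact: (is_cvg_szasz 0 x_ge0 (geometric_growth_szasz_op y_ge0 gg)).
split=> [i||]; [by apply/cvg_ex; eexists; exact: innerE|
  by apply/cvg_ex; eexists; exact: outerE|].
rewrite (cvg_lim _ outerE)//.
(* By the semigroup law, the double sum is the difference of the two sides here at [x] and [y]. *)
have main (u v : R) : 0 <= u -> u <= v ->
    2 * szasz_op (u + v) g 0 <= szasz_op (u + u) g 0 + szasz_op (v + v) g 0.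
  move=> u0 uv; have d0 : 0 <= v - u by rewrite subr_ge0.
  have uu0 := addr_ge0 u0 u0; pose d := v - u.
  have gd := geometric_growth_szasz_op d0 gg.
  have gdd := geometric_growth_szasz_op d0 gd.
  have -> : u + v = (u + u) + d by rewrite /d; ring.
  have -> : v + v = (u + u + d) + d by rewrite /d; ring.
  (* Each term becomes [szasz_op (u + u)] applied to [g] or to its first or second iterate under
     [szasz_op d], so positivity of [szasz_op (u + u)] leaves a pointwise inequality. *)
  rewrite -(szasz_opD 0 (addr_ge0 uu0 d0) d0 gg) -(szasz_opD 0 uu0 d0 gd).
  rewrite -(szasz_opD 0 uu0 d0 gg).
  have ggdd := geometric_growth_lin 1 1 gg gdd.
  have := szasz_op_ge0 0 uu0 (geometric_growth_lin 1 (- 2) ggdd gd).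
  rewrite !szasz_op_lin// => H.
  suff : forall k, 0 <= 1 * (1 * g k + 1 * szasz_op d (szasz_op d g) k) +
      (- 2) * szasz_op d g k by move=> /H; lra.
  move=> k; have := szasz_op_second_difference_ge0 k d0 gg
    (convex_second_difference f_convex).
  by rewrite -/d; lra.
rewrite !szasz_opD//.
have [xy|/ltW yx] := leP x y; first by have := main x y x_ge0 xy; lra.
by have := main y x y_ge0 yx; rewrite (addrC y x); lra.
Qed.
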